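(* Let $\mathcal{X}$ be a Banach space, $V$ a finite dimensional subspace of $\mathcal{X}$, and $M:\mathcal{X}\to\mathbb{R}^m$ a measurement operator with null space $\mathcal{N}\neq\{0\}$ such that $\mathcal{N}\cap V=\{0\}$. (a) For every constant $C>4$ there exists a map $A:\mathbb{R}^m\to\mathcal{X}$, not depending on $\varepsilon$, such that for every $\varepsilon>0$ $$\|f-A(M(f))\|_{\mathcal{X}}\le C\,\mu(\mathcal{N},V)\,\varepsilon\qquad\text{for all } f\in\mathcal{K}(\varepsilon,V),$$ and therefore $$\|f-A(M(f))\|_{\mathcal{X}}\le C\,\mu(\mathcal{N},V)\operatorname{dist}(f,V)_{\mathcal{X}}\qquad\text{for all } f\in\mathcal{X}.$$ (b) For every map $A:\mathbb{R}^m\to\mathcal{X}$ and every $\varepsilon>0$, $$\sup_{f\in\mathcal{K}(\varepsilon,V)}\|f-A(M(f))\|_{\mathcal{X}}\ge\mu(\mathcal{N},V)\,\varepsilon.$$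
   Context: All Banach spaces are real. A measurement operator is a map $M:\mathcal{X}\to\mathbb{R}^m$, $M(f)=(l_1(f),\dots,l_m(f))$, where $l_1,\dots,l_m\in\mathcal{X}^*$ are linearly independent; its null space is $\mathcal{N}=\ker M$. The approximation set is $\mathcal{K}(\varepsilon,V)=\{f\in\mathcal{X}:\operatorname{dist}(f,V)_{\mathcal{X}}\le\varepsilon\}$. For subspaces $X\ne\{0\}$ and $Y$ of $\mathcal{X}$, $\mu(X,Y):=\sup_{x\in X\setminus\{0\}}\frac{\|x\|}{\operatorname{dist}(x,Y)}=\sup_{x\in X\setminus\{0\},\,y\in Y}\frac{\|x\|}{\|x-y\|}$. *)

(* Defs.v *)
From HB Require Import structures.
From mathcomp Require Import all_boot all_order all_algebra.
From mathcomp Require Import all_classical all_reals all_analysis.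
Set Implicit Arguments.
Unset Strict Implicit.
Unset Printing Implicit Defensive.
Import Order.TTheory GRing.Theory Num.Theory.
Import numFieldNormedType.Exports.
Local Open Scope classical_set_scope.
Local Open Scope ring_scope.

(* A finite family spanning V is not required to be free, so V = {0} is
   allowed (take n = 0). *)
Definition finite_dim_subspace (R : realType) (X : lmodType R) (V : set X) :
    Prop :=
  submod_closed (mem V) /\
  exists (n : nat) (b : 'I_n -> X),
    forall v, V v -> exists c : 'I_n -> R, v = \sum_(i < n) c i *: b i.

(* Real-valued infimum: it is the actual distance as soon as V is nonempty,
   in particular for every subspace. *)
Definition dist (R : realType) (X : normedModType R) (f : X) (V : set X) : R :=
  inf [set `|f - v| | v in V].

Definition measurement_operator (R : realType) (X : normedModType R) (m : nat)
    (M : X -> 'rV[R]_m) : Prop :=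
  exists l : 'I_m -> {scalar X},
    [/\ forall i, continuous (l i : X -> R),
        forall c : 'I_m -> R,
          (forall f, \sum_(i < m) c i * l i f = 0) -> forall i, c i = 0
      & forall f, M f = \row_(i < m) l i f].

Definition null_space (R : realType) (X : normedModType R) (m : nat)
    (M : X -> 'rV[R]_m) : set X := [set f | M f = 0].

Definition approx_set (R : realType) (X : normedModType R) (eps : R)
    (V : set X) : set X := [set f | dist f V <= eps].

(* Valued in the extended reals: the inverse of 0 there is +oo, so that
   mu X Y = +oo as soon as some nonzero x in X is at distance 0 from Y. *)
Definition mu (R : realType) (E : normedModType R) (X Y : set E) : \bar R :=
  ereal_sup [set (`|x|%:E / (dist x Y)%:E)%E | x in X `\ 0].

(* Main.v *)
Require Import Defs.
From HB Require Import structures.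
From mathcomp Require Import all_boot all_order all_algebra.
From mathcomp Require Import all_classical all_reals all_analysis.
From mathcomp Require Import ring lra.
Set Implicit Arguments.
Unset Strict Implicit.
Unset Printing Implicit Defensive.
Import Order.TTheory GRing.Theory Num.Theory.
Import numFieldNormedType.Exports.
Local Open Scope classical_set_scope.
Local Open Scope ring_scope.

(** Write N for the null space of M.

    Upper bound.  Two elements f and g of the same fibre of M differ by an
    element of N, so |f - g| <= mu(N, V) dist(f - g, V)
    <= mu(N, V) (dist(f, V) + dist(g, V)) (norm_le_mu_dist, dist_sub).  It is
    therefore enough that A picks in each fibre a point g whose distance to V
    is at most twice that of every other point of the fibre: the error is then
    at most 3 mu(N, V) dist(f, V) (near_optimal_error).  Such a point exists
    by definition of the infimum when the infimum of the distance over the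
    fibre is positive; when it is 0 the fibre has to meet V, which
    uses that V has finite dimension (near_optimal_lift).

    Lower bound.  For x in N, suitably scaled, tx and -tx both lie in the
    approximation set and both are measured as 0, so a single point A(0) must
    serve for the two of them and is at distance at least t|x| from one
    (two_point_lower_bound).

    Finite dimension enters only through a bounded projection.  As M is injective
    on V, linear algebra in the space of measurements gives a linear L with
    values in V and L(Mv) = v on V (subspace_left_inverse).  The projection
    P = L o M is bounded because M is, whence |f - Pf| <= (1 + |P|) dist(f, V)
    (projection_error).  This shows that V is closed, hence that nonzero
    elements of N are at positive distance from V, and it identifies the point
    of V in a fibre with vanishing infimum: it is L(w) for the fibre over w. *)

(** * Distance to a linear subspace *)

Section Distance.
Context (R : realType) (X : normedModType R) (V : set X).

Lemma dist_lb (f : X) : has_lbound [set `|f - v| | v in V].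
Proof. by exists 0 => _ [v _ <-]; exact: normr_ge0. Qed.

Lemma dist_le (f v : X) : V v -> dist f V <= `|f - v|.
Proof. by move=> Vv; apply: ge_inf; [exact: dist_lb|exists v]. Qed.

Hypothesis hV : submod_closed (mem V).

Lemma subspace0 : V 0.
Proof. by case: hV => V0 _; rewrite -in_setE. Qed.

Lemma subspaceP (a : R) (u v : X) : V u -> V v -> V (a *: u + v).
Proof.
case: hV => _ VL Vu Vv; rewrite -in_setE.
by apply: VL; rewrite inE.
Qed.

Lemma subspace_sum (k : nat) (c : 'I_k -> R) (v : 'I_k -> X) :
  (forall i, V (v i)) -> V (\sum_(i < k) c i *: v i).
Proof.
move=> Vv; apply: (big_ind V) => [|x y Vx Vy|i _]; first exact: subspace0.
- by rewrite -[x]scale1r; exact: subspaceP.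
- by rewrite -[X in V X]addr0; apply: subspaceP => //; exact: subspace0.
Qed.

Lemma dist_ge0 (f : X) : 0 <= dist f V.
Proof.
apply: lb_le_inf => [|_ [v _ <-]]; last exact: normr_ge0.
by exists `|f - 0|, 0 => //; exact: subspace0.
Qed.

Lemma dist_adherent (f : X) (e : R) : 0 < e ->
  exists2 v, V v & `|f - v| < dist f V + e.
Proof.
move=> e0; have [|_ [v Vv <-] lt_e] := @inf_adherent R [set `|f - v| | v in V] e e0.
  split; last exact: dist_lb.
  by exists `|f - 0|, 0 => //; exact: subspace0.
by exists v.
Qed.

Lemma dist_sub (f g : X) : dist (f - g) V <= dist f V + dist g V.
Proof.
apply/ler_addgt0Pr => e e0.
have e20 : 0 < e / 2 by rewrite divr_gt0.
have [u Vu ltu] := dist_adherent f e20.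
have [v Vv ltv] := dist_adherent g e20.
have VB : V (u - v) by rewrite addrC -scaleN1r; exact: subspaceP.
apply: le_trans (dist_le (f - g) VB) _.
have -> : f - g - (u - v) = (f - u) - (g - v).
  by rewrite !opprD !opprK addrACA.
apply: le_trans (ler_normB _ _) _.
move: ltu ltv; lra.
Qed.

Lemma dist_scale (a : R) (f : X) : dist (a *: f) V <= `|a| * dist f V.
Proof.
have [->|a0] := eqVneq a 0.
  by have := dist_le 0 subspace0; rewrite subr0 scale0r !normr0 mul0r.
have na0 : 0 < `|a| by rewrite normr_gt0.
apply/ler_addgt0Pr => e e0.
have [v Vv ltv] := dist_adherent f (divr_gt0 e0 na0).
have VZ : V (a *: v).
  by rewrite -[X in V X]addr0; apply: subspaceP => //; exact: subspace0.
apply: le_trans (dist_le _ VZ) _.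
rewrite -scalerBr normrZ.
have -> : `|a| * dist f V + e = `|a| * (dist f V + e / `|a|).
  by field; rewrite gt_eqF.
by rewrite ler_pM2l // ltW.
Qed.

End Distance.

(** * Bounded projections with kernel containing the null space *)

Section Measurement.
Context (R : realType) (X : normedModType R) (m : nat).

(** One bound for all coordinates, rather than a norm on measurements, treats
    m = 0 on the same footing as m > 0. *)
Definition coord_bounded (M : X -> 'rV[R]_m) (K : R) :=
  forall (f : X) (j : 'I_m), `|M f 0 j| <= K * `|f|.

Lemma measurement_operator_linear (M : X -> 'rV[R]_m) :
  measurement_operator M ->
  exists2 L : {linear X -> 'rV[R]_m}, M = L &
    exists2 K : R, 0 <= K & coord_bounded M K.
Proof.
case=> l [lcont _ Ml].
have Mlin : linear M.
  move=> a f g; rewrite !Ml; apply/rowP => j.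
  by rewrite !mxE linearP.
pose L : {linear X -> 'rV[R]_m} :=
  HB.pack M (GRing.isLinear.Build R X 'rV[R]_m *:%R M Mlin).
exists L => //.
have bnd j : exists K : R, 0 <= K /\ forall f, `|l j f| <= K * `|f|.
  have ljlin : linear (l j : X -> R^o) by move=> a f g; rewrite linearP.
  pose lj : {linear X -> R^o} :=
    HB.pack (l j : X -> R^o) (GRing.isLinear.Build R X R^o *:%R _ ljlin).
  have /linear_boundedP/pinfty_ex_gt0[K K0 lK] :=
    @continuous_linear_bounded _ _ _ 0 lj (lcont j 0).
  by exists K; split=> //; exact: ltW.
have [K HK] := choice bnd.
exists (\sum_j K j) => [|f j]; first by apply: sumr_ge0 => j _; case: (HK j).
rewrite Ml mxE; apply: le_trans (proj2 (HK j) f) _.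
apply: ler_wpM2r => //; rewrite (bigD1 j) //= lerDl.
by apply: sumr_ge0 => i _; case: (HK i).
Qed.

(** A family in V whose image has maximal rank works: appending any u in V to
    it cannot increase the rank, so M u is already in the row space. *)
Lemma linear_image_spanned (V : set X) (M : {linear X -> 'rV[R]_m}) :
  submod_closed (mem V) ->
  exists (k : nat) (v : 'I_k -> X), (forall i, V (v i)) /\
    forall u, V u -> (M u <= \matrix_(i < k) M (v i))%MS.
Proof.
move=> hV.
pose P r := `[< exists (k : nat) (v : 'I_k -> X),
  (forall i, V (v i)) /\ \rank (\matrix_(i < k) M (v i)) = r >].
have P0 : exists r, P r.
  exists 0%N; apply/asboolP; exists 0%N, (fun=> 0); split; first by case.
  by rewrite flatmx0 mxrank0.
have Pm r : P r -> (r <= m)%N.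
  by case/asboolP => k [v [_ <-]]; exact: rank_leq_col.
have [r /asboolP[k [v [Vv rv]]] rmax] := ex_maxnP P0 Pm.
exists k, v; split=> // u Vu.
pose v' (i : 'I_k.+1) := if unlift ord0 i is Some j then v j else u.
have Vv' i : V (v' i) by rewrite /v'; case: unlift.
set W := \matrix_(i < k) _; pose W' := \matrix_(i < k.+1) M (v' i).
have uW' : (M u <= W')%MS.
  by apply: (@eq_row_sub _ _ _ _ _ ord0); rewrite rowK /v' unlift_none.
have WW' : (W <= W')%MS.
  apply/row_subP => i; apply: (@eq_row_sub _ _ _ _ _ (lift ord0 i)).
  by rewrite !rowK /v' liftK.
have rW' : (\rank W' <= r)%N.
  by apply: rmax; apply/asboolP; exists k.+1, v'.
apply: submx_trans uW' _.
by rewrite -(geq_leqif (mxrank_leqif_sup WW')) rv.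
Qed.

(** The coordinates of w on a spanning family M (v_i) of M(V), computed with a
    pseudo-inverse and transported to the v_i, define L w.  On M(V) this is a
    section of M with values in V, and M is injective on V. *)
Lemma subspace_left_inverse (V : set X) (M : {linear X -> 'rV[R]_m}) :
  submod_closed (mem V) -> null_space M `&` V = [set 0] ->
  exists L : {linear 'rV[R]_m -> X},
    (forall w, V (L w)) /\ forall u, V u -> L (M u) = u.
Proof.
move=> hV hNV; have [k [v [Vv spanv]]] := linear_image_spanned M hV.
set W := \matrix_(i < k) _ in spanv.
pose L0 (w : 'rV[R]_m) : X := \sum_(i < k) (w *m pinvmx W) 0 i *: v i.
have L0lin : linear L0.
  move=> a w z; rewrite /L0 scaler_sumr -big_split; apply: eq_bigr => i _ /=.
  by rewrite mulmxDl -scalemxAl !mxE scalerDl scalerA.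
pose L : {linear 'rV[R]_m -> X} :=
  HB.pack L0 (GRing.isLinear.Build R 'rV[R]_m X *:%R L0 L0lin).
have VL w : V (L w) by exact: subspace_sum.
exists L; split=> // u Vu.
have ML : M (L (M u)) = M u.
  rewrite -[RHS](mulmxKpV (spanv u Vu)) [RHS]mulmx_sum_row.
  have -> : L (M u) = L0 (M u) by [].
  rewrite linear_sum.
  by apply: eq_bigr => i _; rewrite linearZ rowK.
have : (null_space M `&` V) (L (M u) - u).
  split; first by rewrite /null_space /= linearB ML subrr.
  rewrite addrC -scaleN1r; exact: subspaceP.
by rewrite hNV => /eqP; rewrite subr_eq0 => /eqP.
Qed.

Lemma linear_comp_bounded (M : X -> 'rV[R]_m) (L : {linear 'rV[R]_m -> X})
    (K : R) : 0 <= K -> coord_bounded M K ->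
  exists2 K' : R, 0 <= K' & forall f, `|L (M f)| <= K' * `|f|.
Proof.
move=> K0 MK; exists (\sum_(j < m) K * `|L (delta_mx 0 j)|) => [|f].
  by apply: sumr_ge0 => j _; exact: mulr_ge0.
rewrite {1}[M f]row_sum_delta linear_sum mulr_suml.
apply: le_trans (ler_norm_sum _ _ _) _; apply: ler_sum => j _.
rewrite linearZ normrZ mulrAC; apply: ler_wpM2r => //; exact: MK.
Qed.

(** For v in V one has f - P f = (f - v) - P (f - v), and v may be taken nearly
    optimal. *)
Lemma projection_error (V : set X) (P : {linear X -> X}) (K : R) :
  submod_closed (mem V) -> 0 <= K -> (forall f, `|P f| <= K * `|f|) ->
  (forall u, V u -> P u = u) ->
  forall f, `|f - P f| <= (1 + K) * dist f V.
Proof.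
move=> hV K0 PK Pid f; apply/ler_addgt0Pr => e e0.
have K1 : 0 < 1 + K by rewrite ltr_pwDl.
have [v Vv ltv] := dist_adherent hV f (divr_gt0 e0 K1).
have -> : f - P f = (f - v) - P (f - v).
  by rewrite linearB (Pid _ Vv) opprB addrA subrK.
apply: le_trans (ler_normB _ _) _.
apply: (@le_trans _ _ ((1 + K) * `|f - v|)).
  by rewrite mulrDl mul1r lerD2l.
have -> : (1 + K) * dist f V + e = (1 + K) * (dist f V + e / (1 + K)).
  by field; rewrite gt_eqF.
by rewrite ler_pM2l // ltW.
Qed.

(** If the distance to V has infimum 0 on the fibre over w = M f, its points h
    with dist h V small satisfy |h - L w| <= K' dist h V, since L (M h) = L w;
    so they converge to L w, and M (L w) = w by continuity of M. *)
Lemma near_optimal_lift (V : set X) (M : {linear X -> 'rV[R]_m})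
    (L : {linear 'rV[R]_m -> X}) (K K' : R) :
  submod_closed (mem V) -> coord_bounded M K -> 0 <= K -> 0 <= K' ->
  (forall f, `|f - L (M f)| <= K' * dist f V) -> (forall w, V (L w)) ->
  forall f, exists2 g, M g = M f &
    forall h, M h = M f -> dist g V <= 2 * dist h V.
Proof.
move=> hV MK K0 K'0 LK VL f.
pose D := [set dist h V | h in [set h | M h = M f]].
have Dlb : has_lbound D by exists 0 => _ [h _ <-]; exact: dist_ge0.
have Dinf : has_inf D by split=> //; exists (dist f V), f.
have infD h : M h = M f -> inf D <= dist h V.
  by move=> Mh; apply: ge_inf => //; exists h.
have D0 : 0 <= inf D.
  by apply: lb_le_inf; [exact: Dinf.1|move=> _ [h _ <-]; exact: dist_ge0].
have [Dpos|] := ltP 0 (inf D).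
  (* The slack allowed above the infimum is the infimum itself. *)
  have [_ [g Mg <-] ltg] := inf_adherent Dpos Dinf.
  exists g => // h Mh; have := infD _ Mh; lra.
move=> D_le0; have {D_le0 D0}D_eq0 : inf D = 0 by apply/le_anti/andP.
exists (L (M f)) => [|h Mh]; last first.
  have -> : dist (L (M f)) V = 0.
    apply/le_anti; rewrite dist_ge0 // andbT.
    by have := dist_le (L (M f)) (VL (M f)); rewrite subrr normr0.
  by rewrite mulr_ge0 // dist_ge0.
apply/esym/eqP; rewrite -subr_eq0; apply/eqP/rowP => j.
rewrite [RHS]mxE -linearB; apply/eqP; rewrite -normr_le0.
apply/ler_addgt0Pr => e e0; rewrite add0r.
have K1 : 0 < 1 + K * K' by rewrite ltr_pwDl // mulr_ge0.
have [_ [h Mh <-]] := inf_adherent (divr_gt0 e0 K1) Dinf.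
rewrite D_eq0 add0r ltr_pdivlMr // => /ltW; apply: le_trans.
have -> : M (f - L (M f)) = M (h - L (M h)) by rewrite !linearB Mh.
apply: le_trans (MK _ _) _.
have d0 := dist_ge0 hV h.
apply: (@le_trans _ _ (K * (K' * dist h V))).
  by apply: ler_wpM2l => //; exact: LK.
by rewrite mulrA [leRHS]mulrC ler_wpM2r // lerDr.
Qed.

End Measurement.

(** * The constant mu *)

Section Mu.
Context (R : realType) (X : normedModType R) (N V : set X).
Hypothesis hV : submod_closed (mem V).

Lemma mu_ge0 : (exists2 x, N x & x <> 0) -> (0 <= mu N V)%E.
Proof.
case=> x Nx x0; apply: le_trans (ereal_sup_ubound _); last by exists x.
by rewrite mule_ge0 ?lee_fin // inve_ge0 lee_fin dist_ge0.
Qed.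

(** The positivity assumption excludes the product of +oo by 0, which is 0 in
    the extended reals: for a nonzero x at distance 0 from V the inequality
    would fail. *)
Lemma norm_le_mu_dist (x : X) :
  N x -> (x <> 0 -> 0 < dist x V) -> (`|x|%:E <= mu N V * (dist x V)%:E)%E.
Proof.
move=> Nx dx; have [->|/eqP x0] := eqVneq x 0.
  have -> : dist 0 V = 0.
    apply/le_anti; rewrite dist_ge0 // andbT.
    by have := dist_le 0 (subspace0 hV); rewrite subrr normr0.
  by rewrite mule0 normr0.
have d0 := dx x0.
rewrite -lee_pdivrMr //; apply: ereal_sup_ubound; exists x => //.
by rewrite inver gt_eqF.
Qed.

End Mu.

(** * Error bounds for recovery maps *)

Section Bounds.
Context (R : realType) (X : normedModType R) (m : nat).
Context (V : set X) (M : {linear X -> 'rV[R]_m}).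
Hypothesis hV : submod_closed (mem V).
Hypothesis dist_gt0 : forall x, M x = 0 -> x <> 0 -> 0 < dist x V.

(** A point with at most twice the distance of f yields the factor 1 + 2. *)
Lemma near_optimal_error (A : 'rV[R]_m -> X) (f : X) (C : R) :
  (exists2 x, null_space M x & x <> 0) -> 3 <= C ->
  M (A (M f)) = M f -> dist (A (M f)) V <= 2 * dist f V ->
  (`|f - A (M f)|%:E <= C%:E * mu (null_space M) V * (dist f V)%:E)%E.
Proof.
move=> N0 C3 MA dA; have mu0 := mu_ge0 hV N0.
have NfA : null_space M (f - A (M f)) by rewrite /null_space /= linearB MA subrr.
apply: le_trans (norm_le_mu_dist hV NfA (dist_gt0 NfA)) _.
rewrite [(C%:E * _)%E]muleC -muleA -EFinM; apply: lee_wpmul2l => //.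
rewrite lee_fin; have := dist_sub hV f (A (M f)).
have := dist_ge0 hV f; nra.
Qed.

(** The scale t = eps / dist x V puts t x and - t x in the approximation set;
    both have measurement 0 and their mutual distance is 2 t |x|. *)
Lemma two_point_lower_bound (A : 'rV[R]_m -> X) (eps : R) : 0 < eps ->
  (mu (null_space M) V * eps%:E <=
   ereal_sup [set `|f - A (M f)|%:E | f in approx_set eps V])%E.
Proof.
move=> eps0; set S := ereal_sup _.
rewrite -lee_pdivlMr //; apply: ge_ereal_sup => _ [x [Nx /= x0] <-].
have d0 := dist_gt0 Nx x0.
rewrite inver gt_eqF // lee_pdivlMr // -!EFinM.
set t := eps / dist x V; set g := A 0.
have t0 : 0 < t by rewrite divr_gt0.
have err (s : R) : `|s| = t -> (`|s *: x - g|%:E <= S)%E.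
  move=> st; apply: ereal_sup_ubound; exists (s *: x); last first.
    by rewrite linearZ /= Nx scaler0.
  rewrite /approx_set /=; apply: le_trans (dist_scale hV _ _) _.
  by rewrite st divfK // gt_eqF.
have -> : `|x| / dist x V * eps = t * `|x| by rewrite /t; field; rewrite gt_eqF.
have errp := err t (gtr0_norm t0).
have errn := err (- t) (etrans (normrN t) (gtr0_norm t0)).
have tri : t * `|x| *+ 2 <= `|t *: x - g| + `|- t *: x - g|.
  have -> : t * `|x| *+ 2 = `|(t *: x - g) - (- t *: x - g)|.
    rewrite scaleNr opprB opprK addrA subrK -mulr2n normrMn normrZ.
    by rewrite gtr0_norm.
  exact: ler_normB.
have [le_gt|lt_gt] := leP `|- t *: x - g| `|t *: x - g|.
- by apply: le_trans errp; rewrite lee_fin; move: tri le_gt; lra.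
- by apply: le_trans errn; rewrite lee_fin; move: tri lt_gt; lra.
Qed.

End Bounds.

Theorem mainTheorem3 (R : realType) (X : completeNormedModType R)
    (V : set X) (m : nat) (M : X -> 'rV[R]_m)
    (hV : finite_dim_subspace V) (hM : measurement_operator M)
    (hN : null_space M <> [set 0]) (hNV : null_space M `&` V = [set 0]) :
  (forall C : R, 4 < C ->
     exists A : 'rV[R]_m -> X,
       (forall eps : R, 0 < eps -> forall f, approx_set eps V f ->
          (`|f - A (M f)|%:E <= C%:E * mu (null_space M) V * eps%:E)%E) /\
       (forall f : X,
          (`|f - A (M f)|%:E <= C%:E * mu (null_space M) V * (dist f V)%:E)%E))
  /\
  (forall (A : 'rV[R]_m -> X) (eps : R), 0 < eps ->
     (mu (null_space M) V * eps%:E <=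
      ereal_sup [set `|f - A (M f)|%:E | f in approx_set eps V])%E).
Proof.
have [V_closed _] := hV.
have [ML ME [K K0 MK]] := measurement_operator_linear hM.
move: MK hN hNV; rewrite {M hM}ME => MK hN hNV.
have [L [VL LM]] := subspace_left_inverse V_closed hNV.
have [KP KP0 PK] := linear_comp_bounded L K0 MK.
have Perr f : `|f - L (ML f)| <= (1 + KP) * dist f V.
  exact: (@projection_error R X V (L \o ML) KP).
have dist_gt0 x : ML x = 0 -> x <> 0 -> 0 < dist x V.
  move=> Mx x0; rewrite lt_def dist_ge0 // andbT; apply/eqP => d0; apply: x0.
  have := Perr x; rewrite d0 mulr0 Mx linear0 subr0.
  by rewrite normr_le0 => /eqP.
have N0 : exists2 x, null_space ML x & x <> 0.
  apply: contrapT => N0; apply: hN; apply/seteqP; split=> [x Nx|_ ->] /=.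
    by apply: contrapT => x0; apply: N0; exists x.
  exact: linear0.
split=> [C C4|A eps eps0]; last exact: two_point_lower_bound.
(* The choice is made once per measurement w, before f and eps are known;
     the value 0 outside the range of M is a placeholder. *)
  have lift : forall w, exists g, forall f, ML f = w ->
    ML g = w /\ dist g V <= 2 * dist f V.
  move=> w; have [[f fw]|nfw] := pselect (exists f, ML f = w).
    have [g Mg dg] :=
      near_optimal_lift V_closed MK K0 (addr_ge0 ler01 KP0) Perr VL f.
    by exists g => h hw; rewrite -{1}fw Mg; split=> //; apply: dg; rewrite hw.
  by exists 0 => f fw; case: nfw; exists f.
have [A HA] := choice lift.
have distA f :
    (`|f - A (ML f)|%:E <= C%:E * mu (null_space ML) V * (dist f V)%:E)%E.
  have [MA dA] := HA _ f erefl.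
  by apply: near_optimal_error => //; lra.
exists A; split=> // eps eps0 f Kf; apply: le_trans (distA f) _.
apply: lee_wpmul2l; last by rewrite lee_fin.
by rewrite mule_ge0 ?mu_ge0 // lee_fin; lra.
Qed.
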